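(* Let $H$ be a hypertree with hyperedges of size at most $k$. It is possible to shrink $H$ to a tree $T$ such that for every vertex $v$ of $H$, $$d_T(v) \geq \max\left\{1, \left\lfloor \frac{d_H(v)}{k} \right\rfloor\right\}.$$ In particular, for every vertex $v$ of $H$, $d_T(v)$ is at least $\frac{d_H(v)}{2k}$.
   Context: Here $k$ is a positive integer. A hypergraph is a pair $H=(V,E)$ where $V$ is a finite set (the vertices) and $E$ is a set of subsets of $V$ (the hyperedges). All hypergraphs are assumed simple: there are no loops (hyperedges of size 1) and no repeated hyperedges (distinct hyperedges with identical vertex sets). The degree $d_H(v)$ of a vertex $v$ is the number of hyperedges of $H$ containing $v$; $d_T(v)$ is the usual degree of $v$ in the graph $T$. A hypertree is a hypergraph $H=(V,E)$ such that for each nonempty set $X\subseteq V$, at most $|X|-1$ hyperedges are subsets of $X$, and equality holds if $X=V$ (that is, $|E|=|V|-1$). Shrinking a hypergraph $H=(V,E)$ means choosing, from each hyperedge $e\in E$, a pair of (distinct) vertices of $e$, and forming the graph on the vertex set $V$ whose edges are the chosen pairs (one edge for each hyperedge). Thus $H$ can be shrunk to a tree $T$ on the vertex set $V$ if there is a bijection $e\mapsto e'$ from the hyperedges of $H$ to the edges of $T$ such that both endvertices of $e'$ belong to $e$ for every $e\in E$.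
   Formalization: The bound d_T(v) ≥ max{1, ⌊d_H(v)/k⌋} is stated only for hypertrees with at least two vertices, since it fails for the one-vertex hypertree without hyperedges, where d_T(v) = 0. *)

(* Defs.v *)
From mathcomp Require Import all_boot all_order all_algebra.

Set Implicit Arguments.
Unset Strict Implicit.
Unset Printing Implicit Defensive.

(* Developed with Mathematical Components. A hypergraph on the vertex set V   *)
(* is its set of hyperedges, of type {set {set V}}, so that there are no      *)
(* repeated hyperedges. A graph is a hypergraph whose hyperedges are pairs.   *)

Section Hypergraphs.

Variable V : finType.
Implicit Types (H T : {set {set V}}) (X e : {set V}) (v x y : V).

Definition loopless H : Prop := forall e, e \in H -> #|e| != 1.

Definition is_graph T : Prop := forall e, e \in T -> #|e| = 2.

Definition degree H v : nat := #|[set e in H | v \in e]|.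

(* The second clause is |H| = |V| - 1 without truncated subtraction: it       *)
(* forces V to be nonempty.                                                   *)
Definition hypertree H : Prop :=
  (forall X, X != set0 -> #|[set e in H | e \subset X]| <= #|X| - 1)
  /\ #|H| + 1 = #|V|.

Definition adj T : rel V := fun x y => (x != y) && ([set x; y] \in T).

Definition connected T : Prop := forall x y, connect (adj T) x y.

Definition acyclic T : Prop :=
  forall c : seq V, 2 < size c -> ~ ucycle (adj T) c.

Definition is_tree T : Prop :=
  [/\ 0 < #|V|, is_graph T, connected T & acyclic T].

(* When T is a graph, f e is a pair of distinct vertices of e.                *)
Definition shrinks_to H T : Prop :=
  exists f : {set V} -> {set V},
    [/\ {in H &, injective f}, f @: H = T & forall e, e \in H -> f e \subset e].

End Hypergraphs.

(* Main.v *)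
Require Import Defs.
From mathcomp Require Import all_boot all_order all_algebra.
From mathcomp Require Import zify.

Set Implicit Arguments.
Unset Strict Implicit.
Unset Printing Implicit Defensive.

Import GRing.Theory Num.Theory.

(** The proof has two ingredients, both consequences of one trimming lemma.

    Say that a family of sets satisfies the strong Hall condition when any
    nonempty subfamily of m sets covers more than m points.  Counting the
    hyperedges inside the union of a subfamily shows that the hyperedges of a
    hypertree satisfy it ([hypertree_strong_hall]).  Lovasz's submodularity
    argument shows that, as long as some set of such a family has at least
    three elements, an element of it can be deleted without destroying the
    condition.  Two candidates for deletion suffice, so a point t i chosen in
    advance in the i-th set can be spared, and the family can be trimmed to
    pairs with t i in the i-th pair ([trim_to_pairs]).  For a hypertree the
    resulting pairs form a graph that is again a hypertree
    ([strong_hall_hypertree]), and a graph that is a hypertree is a tree.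

    So H shrinks to a tree T in which the edge coming from e contains t e, for
    any choice of t e in e; hence the degree of v in T is at least the number
    of hyperedges e with t e = v, and at least 1 as soon as there are two
    vertices.  It remains to choose t so that each v is chosen by at least
    floor(d(v) / k) hyperedges ([balanced_representatives]).  This is Hall's
    theorem for floor(d(v) / k) copies of each v, each asking for its own
    hyperedge at v: a set W of vertices demands at most the sum of d(v) / k
    over W, and there are at least that many hyperedges meeting W because each
    of them meets W in at most k vertices.  Hall's theorem in turn follows from
    the trimming lemma, by adding to all the sets a common point that plays
    the role of every t i. *)

(** * Trimming families that satisfy the strong Hall condition *)

Section Trimming.

Variables I V : finType.
Implicit Types (D J K : {set I}) (A B : I -> {set V}) (t : I -> V).

Definition strong_hall D A : bool :=
  [forall J : {set I}, (J \subset D) && (J != set0) ==>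
     (#|J| < #|\bigcup_(i in J) A i|)].

Lemma strong_hallP D A :
  reflect (forall J, J \subset D -> J != set0 ->
             #|J| < #|\bigcup_(i in J) A i|) (strong_hall D A).
Proof.
apply: (iffP forallP) => [h J sJD J0 | h J].
  by have /implyP := h J; apply; rewrite sJD.
by apply/implyP => /andP[]; apply: h.
Qed.

Definition remove_at A i x : I -> {set V} :=
  fun j => if j == i then A i :\ x else A j.

(** A violating subfamily must involve the modified index [i]; the witness [J]
    is that subfamily without [i]. *)
Lemma remove_at_tight D A i x :
  strong_hall D A -> ~~ strong_hall D (remove_at A i x) ->
  exists J, [/\ J \subset D, i \notin J &
    #|(\bigcup_(j in J) A j) :|: (A i :\ x)| <= #|J|.+1].
Proof.
move=> /strong_hallP hA /forallPn [J].
rewrite negb_imply -leqNgt => /andP[/andP[sJD J0] leJ].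
have eqA K : i \notin K ->
    \bigcup_(j in K) remove_at A i x j = \bigcup_(j in K) A j.
  move=> iK; apply: eq_bigr => j jK; rewrite /remove_at.
  by case: eqP jK iK => // -> ->.
have iJ : i \in J.
  apply: contraTT leJ => iJ; rewrite eqA // -ltnNge; exact: hA.
exists (J :\ i); split; first exact: subset_trans (subsetDl _ _) sJD.
  by rewrite !inE eqxx.
have := leJ; rewrite (big_setD1 i) //= eqA ?inE ?eqxx //.
by rewrite /remove_at eqxx setUC (cardsD1 i J) iJ.
Qed.

(** If both deletions failed, the two violating subfamilies J and K would cover
    sets P and Q, of sizes at most |J| + 1 and |K| + 1.  As [x != y], the union
    of P and Q contains all of [A i], so it has at least |J U K| + 2 points by
    the strong Hall condition for i |: J U K.  The intersection has at least
    |J n K| + 1 points, also when J and K are disjoint, since it contains [t].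
    Adding up, |P| + |Q| would exceed |J| + |K| + 2. *)
Lemma remove_one_of_two D A i (t x y : V) :
  strong_hall D A -> i \in D -> t \in A i -> x != y -> t != x -> t != y ->
  strong_hall D (remove_at A i x) || strong_hall D (remove_at A i y).
Proof.
move=> hA iD tA xy tx ty; apply/negPn/negP; rewrite negb_or => /andP[].
move=> /(remove_at_tight hA)[J [sJ iJ leJ]].
move=> /(remove_at_tight hA)[K [sK iK leK]].
move/strong_hallP: hA => hA.
set P := _ :|: _ in leJ; set Q := _ :|: _ in leK.
have union_large : #|J :|: K|.+2 <= #|P :|: Q|.
  have -> : #|J :|: K|.+1 = #|i |: (J :|: K)|.
    by rewrite cardsU1 inE negb_or iJ iK.
  apply: leq_trans (hA _ _ _) _.
  - by rewrite !subUset sub1set iD sJ.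
  - by apply/set0Pn; exists i; rewrite !inE eqxx.
  apply/subset_leq_card/bigcupsP => j; rewrite !inE => /or3P[/eqP->|jJ|jK].
  - apply/subsetP => z zA; rewrite !inE zA !andbT.
    by case: (eqVneq z x) => [->|]; rewrite ?xy ?orbT.
  - by apply/subsetP => z zA; rewrite !inE (introT bigcupP) //; exists j.
  - apply/subsetP => z zA; rewrite !inE [X in _ || (X || _)](introT bigcupP) ?orbT //.
    by exists j.
have inter_large : #|J :&: K|.+1 <= #|P :&: Q|.
  have [->|JK0] := eqVneq (J :&: K) set0.
    rewrite cards0; apply/card_gt0P; exists t.
    by rewrite !inE tA tx ty !orbT.
  apply: leq_trans (hA _ _ JK0) _; first exact: subset_trans (subsetIl _ _) sJ.
  apply/subset_leq_card/bigcupsP => j /setIP[jJ jK]; apply/subsetP => z zA.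
  by rewrite !inE !(introT bigcupP) //; exists j.
have := cardsUI P Q; have := cardsUI J K; lia.
Qed.

(** Induction on the total size of the family: a set with at least three
    elements has two elements other than its marked point [t i], and one of
    these can be deleted. *)
Lemma trim_to_pairs D A t :
  strong_hall D A -> (forall i, i \in D -> t i \in A i) ->
  exists B, strong_hall D B /\
    forall i, i \in D -> [/\ t i \in B i, B i \subset A i & #|B i| = 2].
Proof.
have [n] := ubnP (\sum_(i in D) #|A i|); elim: n A => // n IHn A ltAn hA tA.
have A2 i : i \in D -> 1 < #|A i|.
  move=> iD; have /strong_hallP/(_ [set i]) := hA.
  rewrite big_set1 cards1 sub1set; apply=> //.
  by apply/set0Pn; exists i; rewrite inE.
have [/exists_inP [i iD gtA]|/exists_inPn small] :=
    boolP [exists i in D, 2 < #|A i|]; last first.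
  exists A; split=> // i iD; split; rewrite ?tA //.
  by apply/eqP; rewrite eqn_leq A2 // leqNgt small.
have trim x : x \in A i -> t i != x -> strong_hall D (remove_at A i x) ->
    exists B, strong_hall D B /\
      forall i, i \in D -> [/\ t i \in B i, B i \subset A i & #|B i| = 2].
  move=> xA tx hx; case: (IHn (remove_at A i x)) => //.
  - have -> : \sum_(j in D) #|remove_at A i x j| =
              #|A i :\ x| + \sum_(j in D | j != i) #|A j|.
      rewrite (bigD1 i) //= /remove_at eqxx; congr (_ + _).
      by apply: eq_bigr => j /andP[_ /negPf->].
    by move: ltAn; rewrite (bigD1 i) //= (cardsD1 x (A i)) xA.
  - by move=> j jD; rewrite /remove_at; case: eqP => [->|_]; rewrite ?in_setD1 ?tx tA.
  move=> B [hB BP]; exists B; split=> // j jD; have [tB sB B2] := BP j jD.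
  split=> //; apply: subset_trans sB _; rewrite /remove_at.
  by case: eqP => [->|_]; rewrite ?subsetDl.
have : 1 < #|A i :\ t i| by move: gtA; rewrite (cardsD1 (t i)) tA.
move=> /card_gt1P [x [y [/setD1P[xt xA] /setD1P[yt yA] xy]]].
have tx : t i != x by rewrite eq_sym.
have ty : t i != y by rewrite eq_sym.
have /orP[] := remove_one_of_two hA iD (tA i iD) xy tx ty; exact: trim.
Qed.

(** Two equal pairs would cover only two points, not three. *)
Lemma strong_hall_pairs_inj D B :
  strong_hall D B -> (forall i, i \in D -> #|B i| = 2) -> {in D &, injective B}.
Proof.
move=> /strong_hallP hB B2 i j iD jD eqB; apply: contraTeq isT => ij.
have := hB [set i; j]; rewrite bigcup_setU !big_set1 -eqB setUid B2 // cards2 ij.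
rewrite subUset !sub1set iD jD ltnn; apply=> //.
by apply/set0Pn; exists i; rewrite !inE eqxx.
Qed.

End Trimming.

(** * Hall's theorem and balanced representatives *)

(** Adjoining the common point [None] to every set turns Hall's condition into
    the strong one; trimming with [None] as marked point leaves pairs
    [[set None; Some (f i)]], and distinct indices have distinct pairs. *)
Theorem hall_marriage (I S : finType) (A : I -> {set S}) :
  (forall J : {set I}, #|J| <= #|\bigcup_(i in J) A i|) ->
  exists f : I -> S, injective f /\ forall i, f i \in A i.
Proof.
move=> hA; pose A' i := None |: (Some @: A i).
have hA' : strong_hall setT A'.
  apply/strong_hallP => J _ /set0Pn[i0 i0J].
  have sub : None |: (Some @: \bigcup_(i in J) A i) \subset \bigcup_(i in J) A' i.
    apply/subsetP => z /setU1P[->|/imsetP[s /bigcupP[i iJ sA] ->]].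
      by apply/bigcupP; exists i0; rewrite // !inE.
    by apply/bigcupP; exists i; rewrite // !inE imset_f ?orbT.
  apply: leq_trans (subset_leq_card sub); rewrite cardsU1 card_imset; last first.
    exact: Some_inj.
  by rewrite (_ : None \notin _) ?add1n ?ltnS ?hA //; apply/imsetP => -[].
have [|B [hB BP]] := trim_to_pairs (t := fun=> None) hA'.
  by move=> i _; rewrite !inE.
have /fin_all_exists [f fP] i : exists s, s \in A i /\ B i = [set None; Some s].
  have [NB sB B2] := BP i (in_setT i).
  have /card_gt0P[z] : 0 < #|B i :\ None| by move: B2; rewrite (cardsD1 None) NB; lia.
  case/setD1P => zN zB; have := subsetP sB z zB.
  rewrite !inE (negPf zN) => /imsetP[s sA zE]; exists s; split=> //.
  apply/esym/eqP; rewrite eqEcard cards2 B2 subUset !sub1set NB -zE zB.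
  by rewrite (eq_sym None) zN.
exists f; split=> [i j eqf|i]; last by case: (fP i).
apply: (strong_hall_pairs_inj hB) => //; first by move=> l lD; case: (BP l lD).
by rewrite (fP i).2 (fP j).2 eqf.
Qed.

Section BalancedRepresentatives.

Variable V : finType.
Implicit Types (H : {set {set V}}) (e : {set V}) (v : V).

(** Double counting of the incidences between [W] and the hyperedges that
    meet it. *)
Lemma sum_degree_le H (W : {set V}) k :
  (forall e, e \in H -> #|e| <= k) ->
  \sum_(v in W) degree H v <= #|\bigcup_(v in W) [set e in H | v \in e]| * k.
Proof.
move=> Hk; set U := \bigcup_(v in W) _.
have -> : \sum_(v in W) degree H v = \sum_(v in W) \sum_(e in U) (v \in e : nat).
  apply: eq_bigr => v vW; rewrite -big_mkcondr sum1dep_card; apply: eq_card => e.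
  rewrite !inE; apply/idP/idP => [/andP[eH ve]|/andP[/bigcupP[w _]]].
    by rewrite ve andbT; apply/bigcupP; exists v; rewrite // inE eH.
  by rewrite inE => /andP[-> _].
rewrite exchange_big /= -sum_nat_const; apply: leq_sum => e /bigcupP[w _].
rewrite inE => /andP[eH _]; apply: leq_trans (Hk e eH).
rewrite -big_mkcondr sum1dep_card; apply: subset_leq_card.
by apply/subsetP => v; rewrite inE => /andP[].
Qed.

(** A hyperedge of size at most [k] can give a share 1/k to each of its
    vertices, and [v] then receives d(v) / k in total; the lemma is the
    integral version of this fractional assignment. *)
Lemma balanced_representatives H k :
  0 < k -> 0 < #|V| -> (forall e, e \in H -> 0 < #|e| <= k) ->
  exists t : {set V} -> V, (forall e, e \in H -> t e \in e) /\
    forall v, degree H v %/ k <= #|[set e in H | t e == v]|.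
Proof.
move=> k_gt0 /card_gt0P[v0 _] Hk.
(* The elements of [I] are the copies of the vertices. *)
pose I : finType := {v : V & 'I_(degree H v %/ k)}.
have [J|f [f_inj fP]] := @hall_marriage I _ (fun p => [set e in H | tag p \in e]).
  pose W := [set tag p | p in J].
  have -> : \bigcup_(p in J) [set e in H | tag p \in e] =
            \bigcup_(v in W) [set e in H | v \in e].
    apply/setP => e; apply/bigcupP/bigcupP => [[p pJ pe]|[_ /imsetP[p pJ ->] pe]].
      by exists (tag p) => //; apply: imset_f.
    by exists p.
  rewrite -(leq_pmul2r k_gt0); apply: leq_trans (sum_degree_le _ _); last first.
    by move=> e /Hk /andP[].
  have leJ : #|J| <= \sum_(v in W) degree H v %/ k.
    have -> : \sum_(v in W) degree H v %/ k =
              \sum_(v in W) \sum_(j < degree H v %/ k) 1.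
      by apply: eq_bigr => v _; rewrite sum_nat_const card_ord muln1.
    rewrite sig_big_dep /= sum1dep_card; apply: subset_leq_card.
    by apply/subsetP => p pJ; rewrite inE andbT imset_f.
  apply: leq_trans (leq_mul leJ (leqnn k)) _; rewrite big_distrl /=.
  by apply: leq_sum => v _; apply: leq_trunc_div.
(* A hyperedge matched to a copy of [v] is represented by [v], any other one
   by an arbitrary vertex of it. *)
have /fin_all_exists [t tP] e :
    exists v, (e \in H -> v \in e) /\ forall p, f p = e -> v = tag p.
  have [/existsP[p /eqP pe]|/existsPn nf] := boolP [exists p, f p == e].
    exists (tag p); split=> [_|q qe].
      by have := fP p; rewrite pe inE => /andP[].
    by rewrite (f_inj p q) // pe qe.
  have nofp p : f p = e -> forall v, v = tag p.
    by move=> pe; have := nf p; rewrite pe eqxx.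
  have [eH|_] := boolP (e \in H); last by exists v0; split=> // p /nofp.
  have /andP[/card_gt0P[v ve] _] := Hk e eH.
  by exists v; split=> // p /nofp.
exists t; split=> [e|v]; first by case: (tP e).
pose copy (j : 'I_(degree H v %/ k)) : I :=
  Tagged (fun v => 'I_(degree H v %/ k)) j.
pose g j := f (copy j).
have g_inj : injective g.
  move=> i j /f_inj /eqP.
  by rewrite /copy -tag_eqE /tag_eq eqxx tagged_asE => /eqP.
rewrite -[X in X <= _]card_ord -(card_imset _ g_inj).
apply/subset_leq_card/subsetP => _ /imsetP[j _ ->]; rewrite inE.
have := fP (copy j); rewrite inE => /andP[gH _].
by rewrite gH (proj2 (tP (g j)) (copy j)) /=.
Qed.

End BalancedRepresentatives.

(** * Hypertrees and trees *)

Section Hypertrees.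

Variable V : finType.
Implicit Types (H T : {set {set V}}) (X e : {set V}) (v x y : V).

(** An empty hyperedge would lie inside every singleton, which may contain no
    hyperedge at all. *)
Lemma hypertree_edge_gt0 H e : hypertree H -> e \in H -> 0 < #|e|.
Proof.
move=> [sparse cardH] eH; rewrite card_gt0; apply: contraTneq eH => ->.
have /card_gt0P[v _] : 0 < #|V| by rewrite -cardH addn1.
have /sparse : [set v] != set0 by apply/set0Pn; exists v; rewrite inE.
rewrite cards1 leqn0 cards_eq0 => /eqP/setP/(_ set0).
by rewrite !inE sub0set andbT => ->.
Qed.

Lemma hypertree_strong_hall H : hypertree H -> strong_hall H id.
Proof.
move=> hypH; apply/strong_hallP => J sJ /set0Pn[e eJ].
set X := \bigcup_(e in J) e.
have sX e' : e' \in J -> e' \subset X by move=> ?; apply: bigcup_sup.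
have X_gt0 : 0 < #|X|.
  apply: leq_trans (subset_leq_card (sX e eJ)).
  by apply: hypertree_edge_gt0 hypH _; apply: (subsetP sJ).
have := hypH.1 X; rewrite -card_gt0 => /(_ X_gt0).
suff : #|J| <= #|[set e in H | e \subset X]| by lia.
by apply/subset_leq_card/subsetP => e' e'J; rewrite inE (subsetP sJ) ?sX.
Qed.

(** The sets of the family that lie inside X cover only points of X, so the
    strong Hall condition makes them fewer than |X|. *)
Lemma strong_hall_hypertree H (B : {set V} -> {set V}) :
  #|H| + 1 = #|V| -> strong_hall H B -> {in H &, injective B} ->
  hypertree (B @: H).
Proof.
move=> cardH /strong_hallP hB B_inj; split; last first.
  by rewrite card_in_imset.
move=> X; rewrite -card_gt0 => X_gt0; pose J := [set e in H | B e \subset X].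
have sub : [set e in B @: H | e \subset X] \subset B @: J.
  apply/subsetP => e'; rewrite inE => /andP[/imsetP[e eH ->] sX].
  by rewrite imset_f // inE eH.
apply: leq_trans (subset_leq_card sub) _; apply: leq_trans (leq_imset_card _ _) _.
have [->|J0] := eqVneq J set0; first by rewrite cards0.
have sJ : J \subset H by apply/subsetP => e; rewrite inE => /andP[].
have sX : \bigcup_(e in J) B e \subset X.
  by apply/bigcupsP => e; rewrite inE => /andP[].
by rewrite subn1 -ltnS prednK //; apply: leq_trans (hB J sJ J0) (subset_leq_card sX).
Qed.

Lemma adj_sym T : symmetric (adj T).
Proof. by move=> x y; rewrite /adj eq_sym setUC. Qed.

(** If the component C of [x] is not everything, each edge lies in C or in its
    complement, so there are at most (|C| - 1) + (|V| - |C| - 1) = |V| - 2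
    edges. *)
Lemma hypertree_graph_connected T : is_graph T -> hypertree T -> connected T.
Proof.
move=> graphT [sparse cardT] x y; pose C := [set z | connect (adj T) x z].
apply/negPn/negP => nxy.
have xC : x \in C by rewrite inE connect0.
have yC : y \in ~: C by rewrite !inE.
have sparseC : #|[set e in T | e \subset C]| <= #|C| - 1.
  by apply: sparse; apply/set0Pn; exists x.
have sparseC' : #|[set e in T | e \subset ~: C]| <= #|~: C| - 1.
  by apply: sparse; apply/set0Pn; exists y.
have split_T : T \subset [set e in T | e \subset C] :|: [set e in T | e \subset ~: C].
  apply/subsetP => e eT; rewrite !inE eT /=.
  have /eqP/cards2P[a [b [ab eE]]] := graphT e eT; rewrite eE !subUset !sub1set !inE.
  have adjab : adj T a b by rewrite /adj ab -eE.
  have csym : connect_sym (adj T) by apply: sym_connect_sym; apply: adj_sym.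
  by rewrite (same_connect_r csym (connect1 adjab)); case: connect.
have := leq_trans (subset_leq_card split_T) (leq_card_setU _ _).
have := cardsC C.
have : 0 < #|C| by apply/card_gt0P; exists x.
have : 0 < #|~: C| by apply/card_gt0P; exists y.
lia.
Qed.

(** A cycle of length m at least 3 has m distinct edges inside its set of m
    vertices. *)
Lemma hypertree_acyclic T : hypertree T -> acyclic T.
Proof.
move=> [sparse _] c c_gt2 /andP[cyc uniqc].
(* Length at least 3 enters here; it makes the edges of the cycle distinct. *)
have next2 x : x \in c -> next c (next c x) != x.
  case/rot_to => i p rot_c; rewrite -!(next_rot i uniqc) rot_c.
  move: c_gt2 uniqc; rewrite -(size_rot i c) -(rot_uniq i c) rot_c.
  case: p {rot_c} => [|y [|z p]] //= _; rewrite !inE !negb_or !eqxx.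
  move=> /andP[/and3P[xy xz _] _].
  by rewrite [y == x]eq_sym (negPf xy) eq_sym.
pose edge x := [set x; next c x]; pose X := [set x in c].
have edge_inj : {in X &, injective edge}.
  move=> x y; rewrite !inE => xc yc eqe; apply/eqP/negPn/negP => xy.
  have : x \in edge y by rewrite -eqe !inE eqxx.
  rewrite !inE (negPf xy) /= => /eqP xE.
  have : y \in edge x by rewrite eqe !inE eqxx.
  rewrite !inE eq_sym (negPf xy) /= => /eqP yE.
  by have := next2 y yc; rewrite -xE -yE eqxx.
have X_card : #|X| = size c by rewrite cardsE; apply/card_uniqP.
have edges_in_X : edge @: X \subset [set e in T | e \subset X].
  apply/subsetP => _ /imsetP[x xX ->]; move: xX; rewrite !inE => xc.
  have /andP[_ ->] := next_cycle cyc xc.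
  by rewrite subUset !sub1set !inE xc mem_next.
have X_gt0 : 0 < #|X| by rewrite X_card; lia.
have := leq_trans (subset_leq_card edges_in_X) (sparse X _).
rewrite card_in_imset // -card_gt0 => /(_ X_gt0).
by rewrite leqNgt subn1 prednK // leqnn.
Qed.

(** At most |V| - 2 of the |V| - 1 hyperedges avoid [v]. *)
Lemma hypertree_degree_gt0 T v : 1 < #|V| -> hypertree T -> 0 < degree T v.
Proof.
move=> V_gt1 [sparse cardT]; rewrite lt0n; apply/eqP => /eqP deg0.
have V1 := cardsC [set v]; rewrite cards1 in V1.
have : #|[set e in T | e \subset ~: [set v]]| <= #|~: [set v]| - 1.
  by apply: sparse; rewrite -card_gt0; lia.
suff -> : [set e in T | e \subset ~: [set v]] = T by lia.
apply/setP => e; rewrite inE; case: (boolP (e \in T)) => //= eT.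
apply/subsetP => w we; rewrite !inE; apply: contraTneq deg0 => wv.
by rewrite -lt0n; apply/card_gt0P; exists e; rewrite inE eT -wv.
Qed.

End Hypertrees.

(** * Shrinking a hypertree *)

Theorem theorem2 (k : nat) (V : finType) (H : {set {set V}})
    (k_gt0 : 0 < k)
    (H_simple : loopless H)
    (H_hypertree : hypertree H)
    (H_size : forall e : {set V}, e \in H -> #|e| <= k) :
  exists T : {set {set V}},
    [/\ is_tree T,
        shrinks_to H T,
        1 < #|V| ->
          forall v : V, maxn 1 (degree H v %/ k) <= degree T v
      & forall v : V,
          ((degree H v)%:R / (2 * k)%:R <= (degree T v)%:R :> rat)%R].
Proof.
have V_gt0 : 0 < #|V| by rewrite -H_hypertree.2 addn1.
have Hk e : e \in H -> 0 < #|e| <= k.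
  by move=> eH; rewrite (hypertree_edge_gt0 H_hypertree eH) H_size.
have [t [tP t_deg]] := balanced_representatives k_gt0 V_gt0 Hk.
have [B [hB BP]] := trim_to_pairs (hypertree_strong_hall H_hypertree) tP.
have B2 e : e \in H -> #|B e| = 2 by case/BP.
have B_inj := strong_hall_pairs_inj hB B2.
have hypT := strong_hall_hypertree H_hypertree.2 hB B_inj.
have graphT : is_graph (B @: H) by move=> _ /imsetP[e eH ->]; apply: B2.
have degT v : degree H v %/ k <= degree (B @: H) v.
  apply: leq_trans (t_deg v) _.
  rewrite -(card_in_imset (f := B)); last first.
    by move=> e e'; rewrite !inE => /andP[eH _] /andP[e'H _]; apply: B_inj.
  apply/subset_leq_card/subsetP => e' /imsetP[e].
  rewrite inE => /andP[eH /eqP tv] ->; rewrite inE (imset_f B eH) /=.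
  by have [] := BP e eH; rewrite tv.
exists (B @: H); split.
- split=> //; first exact: hypertree_graph_connected.
  exact: hypertree_acyclic.
- by exists B; split=> // e /BP[].
- by move=> V_gt1 v; rewrite geq_max hypertree_degree_gt0 ?degT.
move=> v; rewrite ler_pdivrMr ?ltr0n ?muln_gt0 //= -natrM ler_nat.
(* With a single vertex there is no hyperedge, and both degrees vanish. *)
have [V_gt1|V_le1] := ltnP 1 #|V|; last first.
  have H0 : H = set0 by apply/eqP; rewrite -cards_eq0; have := H_hypertree.2; lia.
  by rewrite /degree H0 (_ : [set e in set0 | _] = set0) ?cards0 //; apply/setP => e; rewrite !inE.
have T_gt0 := hypertree_degree_gt0 v V_gt1 hypT.
(* d = q k + r with q <= d_T and r < k <= d_T k, so d <= 2 k d_T. *)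
rewrite {1}(divn_eq (degree H v) k) mul2n -addnn mulnDr leq_add //.
  by rewrite leq_mul2r degT orbT.
by apply: leq_trans (ltnW (ltn_pmod _ k_gt0)) (leq_pmull _ T_gt0).
Qed.
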